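(* Let $G$ be a simple graph with vertex set $\{t_1,\ldots,t_s\}$, let $K$ be a field and $S=K[t_1,\ldots,t_s]$, let $I(G)\subset S$ be the edge ideal of $G$, let $\mathcal{P}_G$ be the edge polytope of $G$, and let $A(\mathcal{P}_G)$ be the Ehrhart ring of $\mathcal{P}_G$. The following conditions are equivalent: (i) $K[I(G)z]=A(\mathcal{P}_G)$. (ii) $G$ has at most one non-bipartite connected component $G_i$, and $I(G_i)$ is normal (this last requirement being vacuous if $G$ has no non-bipartite component). (iii) $I(G)$ is normal.
   Context: The edge ideal of $G$ is $I(G)=(\{t_it_j\mid \{t_i,t_j\}\in E(G)\})\subset S$, and similarly for the connected components of $G$. An ideal $I$ is normal if $I^n=\overline{I^n}$ for all $n\geq 1$, where $\overline{I^n}$ is the integral closure of the ideal $I^n$. Let $z$ be a new variable. $K[I(G)z]$ is the monomial subring $K[\{t_it_jz\mid \{t_i,t_j\}\in E(G)\}]\subset S[z]$. The edge polytope is $\mathcal{P}_G={\rm conv}(\{e_i+e_j\mid \{t_i,t_j\}\in E(G)\})\subset\mathbb{R}^s$, where $e_i$ is the $i$-th unit vector. For a lattice polytope $\mathcal{P}\subset\mathbb{R}^s$ whose vertices lie in $\mathbb{N}^s$, the Ehrhart ring of $\mathcal{P}$ is the monomial subring $$A(\mathcal{P})=K[\{t^az^n\mid n\in\mathbb{N},\ a\in n\mathcal{P}\cap\mathbb{Z}^s\}]\subset S[z],$$ where $t^a=t_1^{a_1}\cdots t_s^{a_s}$ and $\mathbb{N}=\{0,1,\ldots\}$. *)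

(* Defs.v *)
From HB Require Import structures.
From mathcomp Require Import all_boot all_order all_algebra.
From mathcomp Require Import classical_sets reals.
From mathcomp Require Import mpoly.

Set Implicit Arguments.
Unset Strict Implicit.
Unset Printing Implicit Defensive.

Import GRing.Theory.
Local Open Scope classical_set_scope.
Local Open Scope ring_scope.

Record sgraph (s : nat) := SGraph {
  adj :> rel 'I_s;
  adj_sym : ssrbool.symmetric adj;
  adj_irr : irreflexive adj }.

Section Graphs.
Variables (s : nat) (G : sgraph s).

Definition components : {set {set 'I_s}} :=
  equivalence_partition (connect G) finset.setT.

Variable C : {set 'I_s}.

Definition induced_adj : rel 'I_s := fun i j => [&& i \in C, j \in C & G i j].

Lemma induced_adj_sym : ssrbool.symmetric induced_adj.
Proof. by move=> i j; rewrite /induced_adj adj_sym andbCA. Qed.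

Lemma induced_adj_irr : irreflexive induced_adj.
Proof. by move=> i; rewrite /induced_adj adj_irr !andbF. Qed.

(* The subgraph of G induced on C.  The vertex type stays 'I_s, so the vertices
   outside C are kept as isolated ones: this adds no edge, hence changes neither
   the generators of the edge ideal, an ideal of K[t_1, ..., t_s] as for G, nor
   bipartiteness. *)
Definition induced : sgraph s := SGraph induced_adj_sym induced_adj_irr.

End Graphs.

Definition bipartite (s : nat) (G : sgraph s) : bool :=
  [exists A : {set 'I_s}, forall i, forall j,
     G i j ==> ((i \in A) != (j \in A))].

Section Ideals.
Variable A : comNzRingType.
Implicit Types (X I : set A) (n : nat).

Definition ideal_gen X : set A :=
  [set f | exists n (c g : 'I_n -> A),
     (forall i, X (g i)) /\ f = \sum_(i < n) c i * g i].

(* For n = 0 this is the unit ideal, generated by the empty product. *)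
Definition ideal_pow I n : set A :=
  ideal_gen [set f | exists g : 'I_n -> A,
    (forall i, I (g i)) /\ f = \prod_(i < n) g i].

Definition integral_closure I : set A :=
  [set f | exists m (a : nat -> A),
     [/\ (0 < m)%N,
         forall i, (1 <= i <= m)%N -> ideal_pow I i (a i)
       & f ^+ m + \sum_(1 <= i < m.+1) a i * f ^+ (m - i) = 0]].

Definition normal_ideal I : Prop :=
  forall n, (1 <= n)%N -> ideal_pow I n = integral_closure (ideal_pow I n).

End Ideals.

Definition edge_ideal (K : fieldType) (s : nat) (G : sgraph s) :
    set {mpoly K[s]} :=
  ideal_gen [set f | exists i j, G i j /\ f = 'X_i * 'X_j].

Definition subalgebra_gen (K : fieldType) (B : algType K) (X : set B) : set B :=
  smallest (fun Y : set B => GRing.subalg_closed (mem Y)) X.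

(* S[z] is {mpoly K[s.+1]}: mwiden embeds S = {mpoly K[s]} in it, and z is the
   last variable. *)
Definition zvar (K : fieldType) (s : nat) : {mpoly K[s.+1]} := 'X_ord_max.

Definition edge_subring (K : fieldType) (s : nat) (G : sgraph s) :
    set {mpoly K[s.+1]} :=
  subalgebra_gen [set f | exists i j,
    G i j /\ f = mwiden ('X_i * 'X_j) * zvar K s].

Section Polytopes.
Variables (R : realType) (s : nat).
Implicit Types (X P : set 'rV[R]_s).

Definition conv X : set 'rV[R]_s :=
  [set v | exists n (w : 'I_n -> R) (p : 'I_n -> 'rV[R]_s),
     [/\ forall i, 0 <= w i, \sum_(i < n) w i = 1,
         forall i, X (p i) & v = \sum_(i < n) w i *: p i]].

Definition dilate (n : nat) P : set 'rV[R]_s :=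
  [set v | exists2 u, P u & v = n%:R *: u].

Definition unit_vec (i : 'I_s) : 'rV[R]_s := delta_mx 0 i.

Definition edge_polytope (G : sgraph s) : set 'rV[R]_s :=
  conv [set v | exists i j, G i j /\ v = unit_vec i + unit_vec j].

Definition vec_of_mnm (a : 'X_{1..s}) : 'rV[R]_s := \row_i (a i)%:R.

(* As the vertices of P lie in N^s, so do the integer points of n P, which is
   why a ranges over 'X_{1..s} = N^s instead of Z^s. *)
Definition ehrhart_ring (K : fieldType) P : set {mpoly K[s.+1]} :=
  subalgebra_gen [set f | exists (n : nat) (a : 'X_{1..s}),
    dilate n P (vec_of_mnm a) /\ f = mwiden 'X_[a] * zvar K s ^+ n].

End Polytopes.

Arguments edge_ideal K {s} G.
Arguments edge_subring K {s} G.
Arguments edge_polytope R {s} G.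
Arguments ehrhart_ring {R s} K P.

(* Main.v *)
Require Import Defs.
From HB Require Import structures.
From mathcomp Require Import all_boot all_order all_algebra.
From mathcomp Require Import classical_sets reals.
From mathcomp Require Import mpoly.
From mathcomp Require Import zify.
(* again, so that finite sets win over their namesakes on classical sets *)
From mathcomp Require Import fintype finset.

(** All three conditions are equivalent to one combinatorial property of [G],
    [linked_odd_walks]: any two closed walks of odd length are joined by an edge.
    (Two such walks that share a vertex are always joined.)

    This property is necessary.  Let [w1] and [w2] be odd closed walks of total
    length [2 n], and let [a] count the visits to each vertex.  The arcs of the two
    walks form [2 n] edges with vertex sum [2 a].  Hence [t^a] has its square in
    [(I(G)^n)^2], so it is integral over [I(G)^n], and [a] lies in [n P_G].  Either
    normality or equality of the two subrings makes [a] the vertex sum of [n]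
    edges.  Those edges would cover the odd number of visits along [w1] using pairs
    inside [w1] if no edge joined [w1] to [w2]: impossible ([perm_cover_linked]).

    It is sufficient, by a packing theorem ([linked_packing]): if all odd closed
    walks are linked, then [n] edges with vertex sum at most [a] exist as soon as
    [2 n <= \sum_i z_i a_i] for the weights [z = cover_weight S], where [S] is any set
    of vertices and [z_i] is [i \notin S] plus [i \in N(S)].  Each vertex [i] is
    replaced by [a_i] clones, and the inequalities are Hall's condition for a
    permutation of the clones, padded with dummies, in which at least [2 n] clones
    go to an adjacent clone.  Its cycles give edges, except that a cycle of odd
    length may waste one clone; two wasteful cycles are linked, so their waste can
    be avoided, and parity makes up for a last one.

    Each [z] has sum at least 2 on every edge, so the inequalities hold at any
    point of [n P_G].  They also hold at the exponents of any [f] integral over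
    [I(G)^n], because the order of vanishing along [t_i |-> t_i u^(z_i)] is a
    valuation that is at least [2 n] on [I(G)^n] ([cover_weight_supp]).

    Lastly, odd closed walks stay within a component, and a component contains one
    exactly when it is not bipartite; so all walks are linked if and only if at most
    one component is not bipartite and its own walks are linked
    ([linked_components]). *)

Set Implicit Arguments.
Unset Strict Implicit.
Unset Printing Implicit Defensive.

Import Order.TTheory GRing.Theory Num.Theory.

(** * Hall's marriage theorem *)

Section Hall.
Variable T : finType.

Definition nbrs (r : T -> {set T}) (S : {set T}) : {set T} :=
  \bigcup_(x in S) r x.

Definition hall (r : T -> {set T}) : Prop :=
  forall S : {set T}, #|S| <= #|nbrs r S|.

(** Rado's argument: if deleting [y1] violates Hall's condition at [S1] and deleting
    [y2] violates it at [S2], then by submodularity of the number of neighbours the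
    original condition fails at [S1 :|: S2] or at [S1 :&: S2] without [x]. *)
Lemma hall_shrink (r : T -> {set T}) (x y1 y2 : T) :
  hall r -> y1 != y2 -> y1 \in r x -> y2 \in r x ->
  exists2 y, y \in r x & hall (fun t => if t == x then r x :\ y else r t).
Proof.
move=> hr ne y1x y2x.
pose r' y t := if t == x then r x :\ y else r t.
have nb_notin y (S : {set T}) : x \notin S -> nbrs (r' y) S = nbrs r S.
  move=> xS; apply: eq_bigr => t tS; rewrite /r'; case: eqP => // tx.
  by rewrite -tx tS in xS.
have nb_in y (S : {set T}) : x \in S ->
    nbrs (r' y) S = (r x :\ y) :|: nbrs r (S :\ x).
  move=> xS; rewrite /nbrs (big_setD1 x) //= {1}/r' eqxx; congr (_ :|: _).
  by apply: nb_notin; rewrite !inE eqxx.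
have fails y : (exists S : {set T}, #|nbrs (r' y) S| < #|S|) \/ hall (r' y).
  have [/existsP h|] := boolP [exists S : {set T}, #|nbrs (r' y) S| < #|S|].
    by left.
  by rewrite negb_exists => /forallP h; right => S; rewrite leqNgt h.
case: (fails y1) => [[S1 h1]|h]; last by exists y1.
case: (fails y2) => [[S2 h2]|h]; last by exists y2.
have in_fail y S : #|nbrs (r' y) S| < #|S| -> x \in S.
  move=> h; apply: contraLR h => xS; rewrite -leqNgt nb_notin //; exact: hr.
have xS1 := in_fail _ _ h1; have xS2 := in_fail _ _ h2.
rewrite nb_in // in h1; rewrite nb_in // in h2.
have {}h1 : #|(r x :\ y1) :|: nbrs r (S1 :\ x)| <= #|S1 :\ x|.
  by move: h1; rewrite (cardsD1 x S1) xS1.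
have {}h2 : #|(r x :\ y2) :|: nbrs r (S2 :\ x)| <= #|S2 :\ x|.
  by move: h2; rewrite (cardsD1 x S2) xS2.
move: h1 h2 (hr (S1 :|: S2)) (hr ((S1 :\ x) :&: (S2 :\ x))).
set U1 := _ :|: _; set U2 := (_ :\ y2) :|: _.
set A1 := S1 :\ x; set A2 := S2 :\ x => h1 h2 hU hI.
have sU : nbrs r (S1 :|: S2) \subset U1 :|: U2.
  apply/bigcupsP => t; have [-> _|tx] := eqVneq t x.
    apply/subsetP => z zx; rewrite !inE zx !andbT.
    by have [->|] := eqVneq z y1; rewrite ?ne ?orbT.
  rewrite inE => /orP[tS|tS].
    apply: subset_trans (subsetUl _ _); apply: subset_trans (subsetUr _ _).
    by apply: (bigcup_sup t) => //; rewrite !inE tx.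
  apply: subset_trans (subsetUr _ _); apply: subset_trans (subsetUr _ _).
  by apply: (bigcup_sup t) => //; rewrite !inE tx.
have sI : nbrs r (A1 :&: A2) \subset U1 :&: U2.
  apply/bigcupsP => t; rewrite inE => /andP[t1 t2]; rewrite subsetI.
  rewrite !(subset_trans _ (subsetUr _ _)) //; exact: (bigcup_sup t).
have {}sU := subset_leq_card sU; have {}sI := subset_leq_card sI.
have cU : #|S1 :|: S2| = #|A1 :|: A2|.+1.
  rewrite (cardsD1 x) inE xS1 /= add1n; congr (_.+1); apply: eq_card => t.
  by rewrite !inE; case: eqP.
have e1 := cardsUI U1 U2; have e2 := cardsUI A1 A2; lia.
Qed.

(** Shrinking the sets [r x] while Hall's condition persists ends with singletons,
    whose elements are then forced to be distinct. *)
Lemma hall_marriage (r : T -> {set T}) :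
  hall r -> exists2 f : T -> T, injective f & forall x, f x \in r x.
Proof.
have [k] := ubnP (\sum_x #|r x|); elim: k r => // k IHk r lek hr.
have [/existsP[x /card_gt1P[y1 [y2 [y1x y2x ne]]]]|] :=
    boolP [exists x, 1 < #|r x|].
  have [y yx hr'] := hall_shrink hr ne y1x y2x.
  have [|f fI fr] := IHk _ _ hr'.
    rewrite -ltnS; apply: leq_trans lek; rewrite ltnS (bigD1 x) //= eqxx [ltnRHS](bigD1 x) //=.
    rewrite (cardsD1 y (r x)) yx add1n addSn ltnS; apply: leq_add => //.
    by apply: leq_sum => t /negPf ->.
  exists f => // t; have := fr t; case: eqP => // ->.
  by rewrite inE => /andP[].
rewrite negb_exists => /forallP le1.
have ex1 x : {y | r x = [set y]}.
  apply/sig_eqW/cards1P; rewrite eqn_leq leqNgt le1 /=.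
  by have := hr [set x]; rewrite cards1 /nbrs big_set1.
exists (fun x => sval (ex1 x)) => [x y /= exy|x]; last by rewrite {2}(svalP (ex1 x)) set11.
have := hr [set x; y]; rewrite cards2 /nbrs bigcup_setU !big_set1.
rewrite (svalP (ex1 x)) (svalP (ex1 y)) exy setUid cards1.
by have [|] := eqVneq x y.
Qed.
End Hall.

(** * Odd closed walks and matchings *)

Definition endpoints (T : Type) (E : seq (T * T)) : seq T :=
  flatten [seq [:: p.1; p.2] | p <- E].

Lemma endpoints_cat (T : Type) (E F : seq (T * T)) :
  endpoints (E ++ F) = endpoints E ++ endpoints F.
Proof. by rewrite /endpoints map_cat flatten_cat. Qed.

Lemma size_endpoints (T : Type) (E : seq (T * T)) :
  size (endpoints E) = (size E).*2.
Proof. by elim: E => //= p E ->. Qed.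

Definition edges_of (T : Type) (e : rel T) (E : seq (T * T)) : bool :=
  all (fun p => e p.1 p.2) E.

Lemma edges_of_cat (T : Type) (e : rel T) (E F : seq (T * T)) :
  edges_of e (E ++ F) = edges_of e E && edges_of e F.
Proof. exact: all_cat. Qed.

Definition odd_closed_walk (T : eqType) (e : rel T) (w : seq T) : bool :=
  cycle e w && odd (size w).

(** The two walks may share a vertex: the successor of that vertex in [w2] is then
    the [y] of the edge. *)
Definition linked_odd_walks (T : eqType) (e : rel T) : Prop :=
  forall w1 w2 : seq T, odd_closed_walk e w1 -> odd_closed_walk e w2 ->
  exists x y, [/\ x \in w1, y \in w2 & e x y].

Section Matching.
Variables (T : finType) (e : rel T).

Fixpoint num_arcs (x : T) (p : seq T) : nat :=
  if p is y :: q then e x y + num_arcs y q else 0.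

(** Greedy matching: taking the arc from [x] to [y] sacrifices only the arc that
    leaves [y], so at least half of the arcs are kept. *)
Lemma path_matching x p : exists E : seq (T * T),
  [/\ edges_of e E, subseq (endpoints E) (x :: p) &
      num_arcs x p <= (size E).*2].
Proof.
have [k] := ubnP (size p); elim: k x p => // k IHk x [|y p] /=.
  by exists [::].
rewrite !ltnS => lek; case exy: (e x y); last first.
  have [E [aE sE nE]] := IHk y p lek; exists E; split=> //.
  exact: subseq_trans sE (subseq_cons _ _).
case: p lek => [|z p] lek; first by exists [:: (x, y)]; rewrite /= exy !eqxx.
have [E [aE sE nE]] := IHk z p (ltnW lek).
exists ((x, y) :: E); rewrite /= exy !eqxx; split=> //.
by have := leq_b1 (e y z); move: nE => /=; lia.
Qed.

Lemma cycle_num_arcs x p : cycle e (x :: p) -> num_arcs x p = size p.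
Proof.
rewrite /= -cats1 cat_path => /andP[+ _].
by elim: p x => //= y p IHp x /andP[-> /IHp->].
Qed.

(** One arc of the cycle is lost by cutting it open, but the number of arcs left is
    odd, so rounding gains it back. *)
Lemma even_path_cover x p : cycle e (x :: p) -> ~~ odd (size p).+1 ->
  exists E : seq (T * T),
  [/\ edges_of e E, subseq (endpoints E) (x :: p) & (size p).+1 = (size E).*2].
Proof.
move=> cyc ev; have [E [aE sE nE]] := path_matching x p; exists E; split=> //.
have := size_subseq sE; rewrite size_endpoints /=.
rewrite (cycle_num_arcs cyc) in nE; lia.
Qed.

(** An odd closed walk minus any one of its vertices is an even path, hence perfectly
    matched. *)
Lemma odd_walk_minus_vertex x w : odd_closed_walk e w -> x \in w -> uniq w ->
  exists E : seq (T * T),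
  [/\ edges_of e E, subseq (endpoints E) (behead (rot (index x w) w)) &
      size w = (size E).*2.+1].
Proof.
move=> /andP[cw ow] xw uw.
have := rot_index xw; set p := _ ++ _ => def_w; rewrite def_w /=.
rewrite -(rot_cycle (index x w)) def_w in cw.
rewrite -(size_rot (index x w)) def_w /= in ow *.
case: p cw ow {def_w} => [|y p] cw ow; first by exists [::].
have [E [aE sE nE]] := path_matching y p; exists E; split=> //.
have := size_subseq sE; rewrite size_endpoints /=.
have := cycle_num_arcs cw => /=; have : e x y <= 1 by case: (e x y).
by move: ow => /=; lia.
Qed.

(** The linking edge takes one vertex from each walk, and what remains of each is
    perfectly matched. *)
Lemma join_odd_walks (w1 w2 : seq T) : linked_odd_walks e ->
  odd_closed_walk e w1 -> odd_closed_walk e w2 -> uniq (w1 ++ w2) ->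
  exists E : seq (T * T),
  [/\ edges_of e E, uniq (endpoints E), {subset endpoints E <= w1 ++ w2} &
      size (w1 ++ w2) = (size E).*2].
Proof.
move=> link o1 o2; rewrite cat_uniq => /and3P[u1 /hasPn dis u2].
have [x [y [xw yw exy]]] := link _ _ o1 o2.
have [E1 [a1 s1 n1]] := odd_walk_minus_vertex o1 xw u1.
have [E2 [a2 s2 n2]] := odd_walk_minus_vertex o2 yw u2.
have rot1 := rot_index xw; have rot2 := rot_index yw.
rewrite rot1 /= in s1; rewrite rot2 /= in s2.
move: rot1 rot2 s1 s2; set p1 := _ ++ _; set p2 := _ ++ _ => rot1 rot2 s1 s2.
have m1 : w1 =i x :: p1 by move=> z; rewrite -rot1 mem_rot.
have m2 : w2 =i y :: p2 by move=> z; rewrite -rot2 mem_rot.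
have {}u1 : uniq (x :: p1) by rewrite -rot1 rot_uniq.
have {}u2 : uniq (y :: p2) by rewrite -rot2 rot_uniq.
have dis12 z : z \in y :: p2 -> z \notin x :: p1 by rewrite -m1 -m2; apply: dis.
have sub1 := mem_subseq s1; have sub2 := mem_subseq s2.
exists ((x, y) :: E1 ++ E2); split.
- by rewrite /= exy -/(edges_of e (E1 ++ E2)) edges_of_cat a1.
- have perm : perm_eq (endpoints ((x, y) :: E1 ++ E2))
     ((x :: endpoints E1) ++ (y :: endpoints E2)).
    rewrite /endpoints /= -!/(endpoints _) endpoints_cat perm_cons.
    by rewrite (perm_catCA [:: y] _ _).
  rewrite (perm_uniq perm); apply: (subseq_uniq (s2 := (x :: p1) ++ (y :: p2))).
    by apply: cat_subseq; rewrite /= eqxx.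
  by rewrite cat_uniq u1 u2 andbT; apply/hasPn.
- move=> z; rewrite [z \in w1 ++ w2]mem_cat m1 m2.
  rewrite /endpoints /= -!/(endpoints _) endpoints_cat !inE mem_cat.
  by do 2![case/predU1P=> [->|]; rewrite ?eqxx ?orbT //];
     case/orP=> [/sub1|/sub2] ->; rewrite ?orbT.
- by rewrite size_cat /= size_cat n1 n2; lia.
Qed.

Lemma orbit_num_arcs (f : T -> T) x p : fpath f x p ->
  num_arcs x p + e (last x p) (f (last x p)) = count (fun t => e t (f t)) (x :: p).
Proof.
by elim: p x => [|y p IHp] x /=; [rewrite addn0 | case/andP=> /eqP<- /IHp /= <-; lia].
Qed.

Variables (f : T -> T).
Hypothesis fI : injective f.

Definition good_arcs (S : {set T}) : {set T} := [set t in S | e t (f t)].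

(** The invariant that is carried from orbit to orbit of [f]: edges that account for
    all good arcs, up to a single odd closed walk that waits for a partner. *)
Definition almost_matched (S : {set T}) : Prop :=
  exists (E : seq (T * T)) (w : seq T),
    [/\ edges_of e E, w = [::] \/ odd_closed_walk e w, uniq (endpoints E ++ w),
       {subset endpoints E ++ w <= S} & #|good_arcs S| <= (size E).*2 + size w].

Definition orbit_set (x : T) : {set T} := [set t | t \in orbit f x].

Lemma orbit_set_closed x t : (f t \in orbit_set x) = (t \in orbit_set x).
Proof. by rewrite !inE -!fconnect_orbit -same_fconnect1_r. Qed.

Lemma orbit_set_sub (S : {set T}) x :
  (forall t, (f t \in S) = (t \in S)) -> x \in S -> orbit_set x \subset S.
Proof.
move=> clS xS; apply/subsetP => t; rewrite inE -fconnect_orbit => /iter_findex <-.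
by elim: (findex _ _ _) => //= i; rewrite clS.
Qed.

Lemma almost_matched_orbit (S : {set T}) x : linked_odd_walks e ->
    orbit_set x \subset S -> almost_matched (S :\: orbit_set x) ->
    (exists E : seq (T * T), [/\ edges_of e E, uniq (endpoints E),
       {subset endpoints E <= orbit f x} &
       count (fun t => e t (f t)) (orbit f x) <= (size E).*2]) \/
    odd_closed_walk e (orbit f x) ->
  almost_matched S.
Proof.
move=> link subO [E [w [eE ow uE sE nE]]] alt.
have inO t : t \in orbit f x -> t \in S.
  by move=> tO; apply: (subsetP subO); rewrite inE.
have sES t : t \in endpoints E ++ w -> (t \in S) && (t \notin orbit f x).
  by move/sE; rewrite !inE andbC.
have sEl t : t \in endpoints E -> (t \in S) && (t \notin orbit f x).
  by move=> tE; apply: sES; rewrite mem_cat tE.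
have sEr t : t \in w -> (t \in S) && (t \notin orbit f x).
  by move=> tw; apply: sES; rewrite mem_cat tw orbT.
have cS : #|good_arcs S| =
    #|good_arcs (S :\: orbit_set x)| + count (fun t => e t (f t)) (orbit f x).
  rewrite -size_filter -(card_uniqP _) ?filter_uniq ?orbit_uniq //.
  rewrite -(cardsID (orbit_set x) (good_arcs S)) addnC; congr (_ + _); apply: eq_card => t.
    by rewrite !inE andbA.
  rewrite !inE mem_filter andbC; case tO: (t \in orbit f x); rewrite ?andbF //=.
  by rewrite inO // andbT.
have disj (t : seq T) : {subset t <= orbit f x} -> ~~ has (mem (endpoints E ++ w)) t.
  by move=> tO; apply/hasPn => y /tO yO; apply/negP => /sES; rewrite yO andbF.
case: alt => [[F [eF uF sF nF]]|oO].
  exists (F ++ E), w; split=> //.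
  - by rewrite edges_of_cat eF.
  - by rewrite endpoints_cat -catA uniq_catC cat_uniq uE uF andbT /=; apply: disj.
  - move=> t; rewrite endpoints_cat -catA mem_cat => /orP[/sF/inO //|].
    by case/sES/andP.
  - by rewrite cS size_cat; lia.
have size_O := count_size (fun t => e t (f t)) (orbit f x).
case: ow => [w0|ow].
  subst w; rewrite cats0 addn0 in uE nE disj.
  exists E, (orbit f x); split=> //.
  - by right.
  - by rewrite cat_uniq uE orbit_uniq andbT /=; apply: disj.
  - by move=> t; rewrite mem_cat => /orP[/sEl/andP[]//|/inO].
  - by rewrite cS; lia.
move: uE; rewrite cat_uniq => /and3P[uE /hasPn dEw uw].
(* the orbit and the walk left over so far are two odd closed walks *)
have [|F [eF uF sF nF]] := join_odd_walks link oO ow.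
  rewrite cat_uniq orbit_uniq uw andbT; apply/hasPn => t /sEr/andP[_ tO] //.
exists (F ++ E), [::]; rewrite cats0; split=> //.
- by rewrite edges_of_cat eF.
- by left.
- rewrite endpoints_cat uniq_catC cat_uniq uF uE andbT /=.
  apply/hasPn => t /sF; rewrite mem_cat => /orP[tO|/dEw//].
  by apply/negP => /= /sEl; rewrite tO andbF.
- move=> t; rewrite endpoints_cat mem_cat => /orP[/sF|/sEl/andP[]//].
  by rewrite mem_cat => /orP[/inO|/sEr/andP[]].
- by move: nF; rewrite cS !size_cat; lia.
Qed.

Lemma closed_almost_matched (S : {set T}) : linked_odd_walks e ->
  (forall t, (f t \in S) = (t \in S)) -> almost_matched S.
Proof.
move=> link; have [k] := ubnP #|S|; elim: k S => // k IHk S; rewrite ltnS => lek clS.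
have [->|[x0 x0S]] := set_0Vmem S.
  exists [::], [::]; split; rewrite //=; first by left.
  by rewrite leqn0 cards_eq0; apply/eqP/setP=> t; rewrite !inE.
have step x : x \in S ->
    (exists E : seq (T * T), [/\ edges_of e E, uniq (endpoints E),
       {subset endpoints E <= orbit f x} &
       count (fun t => e t (f t)) (orbit f x) <= (size E).*2]) \/
    odd_closed_walk e (orbit f x) -> almost_matched S.
  move=> xS; have subO := orbit_set_sub clS xS.
  apply: almost_matched_orbit => //; apply: IHk; last first.
    by move=> t; rewrite !in_setD clS orbit_set_closed.
  apply: leq_trans lek; apply: proper_card; rewrite properE subsetDl /=.
  by apply/subsetPn; exists x => //; rewrite !inE -fconnect_orbit connect0.
have orb x : orbit f x = x :: traject f (f x) (order f x).-1.
  by rewrite /orbit -orderSpred.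
have [/existsP[y /andP[yS bad]]|] := boolP [exists y, (y \in S) && ~~ e y (f y)].
  (* cut at the missing arc from y, the orbit is a path that starts at f y *)
  apply: (step (f y)); first by rewrite clS.
  have [E [eE sE nE]] := path_matching (f y) (traject f (f (f y)) (order f (f y)).-1).
  left; exists E; rewrite -orb in sE; split=> //.
  - exact: subseq_uniq sE (orbit_uniq _ _).
  - exact: mem_subseq.
  - rewrite orb -orbit_num_arcs; last exact: fpath_traject.
    by rewrite last_traject -/(finv f (f y)) finv_f // (negPf bad) addn0.
rewrite negb_exists => /forallP all_good; apply: (step x0 x0S).
have cyc : cycle e (orbit f x0).
  apply: (sub_in_cycle (P := mem S) (e := frel f)).
  + by move=> t u tS _ /eqP <-; have := all_good t; rewrite [t \in S]tS negbK.
  + by apply/allP => t tO; apply: (subsetP (orbit_set_sub clS x0S)); rewrite inE.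
  + exact: cycle_orbit.
have [od|ev] := boolP (odd (size (orbit f x0))).
  by right; rewrite /odd_closed_walk cyc.
left; rewrite orb in cyc ev; have [E [eE sE nE]] := even_path_cover cyc ev.
exists E; rewrite -orb in sE; split=> //.
- exact: subseq_uniq sE (orbit_uniq _ _).
- exact: mem_subseq.
- by rewrite -nE; apply: leq_trans (count_size _ _) _; rewrite orb.
Qed.

(** A permutation with [k] good arcs behaves like a fractional matching of size
    [k / 2]; here it is rounded to an integral one, losing at most the half that
    comes from one unpaired odd orbit. *)
Lemma injective_matching : linked_odd_walks e ->
  exists E : seq (T * T), [/\ edges_of e E, uniq (endpoints E) &
    #|[set t | e t (f t)]| <= (size E).*2.+1].
Proof.
move=> link; have [|E [w [eE ow uE _]]] := closed_almost_matched (S := setT) link.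
  by move=> t; rewrite !inE.
have -> : good_arcs setT = [set t | e t (f t)] by apply/setP => t; rewrite !inE.
case: ow uE => [->|ow] uE nE.
  by exists E; rewrite cats0 addn0 in uE nE; split=> //; apply: leqW.
case: w ow uE nE => [/andP[]//|x w] ow uE nE.
have xw : x \in x :: w by rewrite inE eqxx.
move: uE; rewrite cat_uniq => /and3P[uE disj uw].
have [F [eF]] := odd_walk_minus_vertex ow xw uw.
rewrite /= eqxx rot0 /= => sF nF.
exists (E ++ F); split.
- by rewrite edges_of_cat eE eF.
- apply: (subseq_uniq (s2 := endpoints E ++ x :: w)).
    rewrite endpoints_cat; apply: cat_subseq => //.
    exact: subseq_trans sF (subseq_cons _ _).
  by rewrite cat_uniq uE disj.
- by move: nE nF; rewrite /= size_cat; lia.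
Qed.
End Matching.

(** * Packing edges under vertex capacities *)

Section Packing.
Variables (I : finType) (e : rel I).

(** Up to the factor 2, the half-integral vertex covers that Hall's condition on the
    set [S] asks for. *)
Definition cover_weight (S : {set I}) (i : I) : nat :=
  (i \notin S) + [exists j in S, e j i].

Variables (a : I -> nat) (d : nat).

Definition clone : finType := {i : I & 'I_(a i)}.
(** The [d] dummies absorb the clones that a matching leaves uncovered. *)
Definition padded : finType := (clone + 'I_d)%type.

Lemma card_clone (P : pred I) :
  #|[pred v : clone | P (tag v)]| = \sum_(i | P i) a i.
Proof.
rewrite -sum1_card.
transitivity (\sum_(i | P i) \sum_(k < a i) 1); last first.
  by apply: eq_bigr => i _; rewrite sum_nat_const card_ord muln1.
by rewrite sig_big_dep; apply: eq_bigl => v; rewrite !inE andbT.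
Qed.

Definition padded_rel : rel padded := fun x y =>
  match x, y with inl u, inl v => e (tag u) (tag v) | _, _ => false end.

Definition padded_nbrs (x : padded) : {set padded} :=
  [set y | match x, y with
           | inl u, inl v => e (tag u) (tag v)
           | inr _, inr _ => false
           | _, _ => true end].

Lemma card_padded (S : {set padded}) :
  #|S| = #|[pred v : clone | inl v \in S]| + #|[pred k : 'I_d | inr k \in S]|.
Proof. by rewrite -!sum1_card big_sumType. Qed.

(** For a set of clones, Hall's condition is tightest on all the clones of a set [J]
    of vertices, where it is the hypothesis at [J]; a set with a dummy already sees
    all the clones. *)
Lemma padded_hall : d <= \sum_i a i ->
  (forall S : {set I}, \sum_i a i <= d + \sum_i cover_weight S i * a i) ->
  hall padded_nbrs.
Proof.
move=> led cov S.
have cardT : #|clone| = \sum_i a i by rewrite -(card_clone predT).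
have nbrsP x y : x \in S -> y \in padded_nbrs x -> y \in nbrs padded_nbrs S.
  by move=> xS yx; apply/bigcupP; exists x.
have [/existsP[k kS]|] := boolP [exists k, inr k \in S].
  have inlN v : inl v \in nbrs padded_nbrs S.
    by apply: (nbrsP (inr k)); rewrite ?inE.
  have leN : \sum_i a i <= #|nbrs padded_nbrs S|.
    rewrite (card_padded) -cardT; apply: leq_trans (leq_addr _ _).
    by apply: subset_leq_card; apply/subsetP => v _; rewrite inE; apply: inlN.
  have [/existsP[v vS]|] := boolP [exists v, inl v \in S].
    suff -> : nbrs padded_nbrs S = setT by apply: subset_leq_card; apply: subsetT.
    apply/setP => -[u|l]; rewrite inE ?inlN //.
    by apply: (nbrsP (inl v)); rewrite ?inE.
  rewrite negb_exists => /forallP inlS; apply: leq_trans leN.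
  apply: leq_trans led; rewrite (card_padded) [X in X + _]eq_card0 ?add0n.
    by rewrite -[leqRHS]card_ord; apply: max_card.
  by move=> v; rewrite !inE; apply: negPf (inlS v).
rewrite negb_exists => /forallP inrS.
have [->|[x0 x0S]] := set_0Vmem S; first by rewrite cards0.
pose J := [set i | [exists v, (inl v \in S) && (tag v == i)]].
have leS : #|S| <= \sum_(i in J) a i.
  rewrite (card_padded) [X in _ + X]eq_card0 ?addn0; last first.
    by move=> k; rewrite !inE; apply: negPf (inrS k).
  rewrite -(card_clone (mem J)); apply: subset_leq_card; apply/subsetP => v.
  by rewrite !inE => vS; apply/existsP; exists v; rewrite vS eqxx.
have leN : d + \sum_(i | [exists j in J, e j i]) a i <= #|nbrs padded_nbrs S|.
  rewrite (card_padded) addnC; apply: leq_add.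
    rewrite -(card_clone [pred i | [exists j in J, e j i]]).
    apply: subset_leq_card; apply/subsetP => v; rewrite !inE.
    case/existsP=> j /andP[]; rewrite inE => /existsP[u /andP[uS /eqP<-]] uv.
    by apply: (nbrsP (inl u)); rewrite ?inE.
  rewrite -[leqLHS]card_ord; apply: subset_leq_card; apply/subsetP => k _.
  rewrite inE /=; apply: (nbrsP x0) => //.
  by case: x0 x0S => [v|l] lS; rewrite ?inE //; have := inrS l; rewrite lS.
apply: leq_trans leN; apply: leq_trans leS _.
have sum_if (P : pred I) : \sum_i P i * a i = \sum_(i | P i) a i.
  by rewrite [RHS]big_mkcond; apply: eq_bigr => i _; case: (P i); rewrite ?mul1n.
have covE : \sum_i cover_weight J i * a i =
    \sum_(i | i \notin J) a i + \sum_(i | [exists j in J, e j i]) a i.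
  by rewrite -!sum_if -big_split; apply: eq_bigr => i _; rewrite /= -mulnDl.
by have := cov J; rewrite covE (bigID (mem J)) /=; lia.
Qed.

End Packing.

(** Dummies have no arc, so an odd closed walk visits clones only. *)
Lemma linked_padded (I : finType) (e : rel I) (a : I -> nat) (d : nat) :
  linked_odd_walks e -> linked_odd_walks (@padded_rel I e a d).
Proof.
move=> link.
have lift (w : seq (padded a d)) : odd_closed_walk (@padded_rel I e a d) w ->
    exists2 u : seq (clone a), w = map inl u & odd_closed_walk e (map tag u).
  case/andP => cw ow.
  have [u def_w] : exists u : seq (clone a), w = map inl u.
    have : all (fun x => if x is inl _ then true else false) w.
      apply/allP => x /(next_cycle cw); by case: x.
    elim: w {cw ow} => [|[v|k] w IHw] //=; first by exists [::].
    by move/IHw => [u ->]; exists (v :: u).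
  exists u => //; rewrite def_w size_map in ow; rewrite def_w cycle_map in cw.
  by rewrite /odd_closed_walk size_map ow cycle_map cw.
move=> w1 w2 /lift[u1 -> o1] /lift[u2 -> o2].
have [_ [_ [/mapP[v1 v1u ->] /mapP[v2 v2u ->] e12]]] := link _ _ o1 o2.
by exists (inl v1), (inl v2); split=> //; apply: map_f.
Qed.

(** An integral max-min theorem for packing [n] edges with at most [a i] of them at
    each [i].  Without linked odd walks the inequalities only give a half-integral
    packing.  At most [d] of the [2 n + d] clones are sent to dummies, which leaves at
    least [2 n] good arcs. *)
Lemma linked_packing (I : finType) (e : rel I) (a : I -> nat) (n : nat) :
    linked_odd_walks e ->
    (forall S : {set I}, n.*2 <= \sum_i cover_weight e S i * a i) ->
  exists E : seq (I * I), [/\ edges_of e E, size E = n &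
    forall i, count_mem i (endpoints E) <= a i].
Proof.
move=> link cov.
(* the number of clones that [n] disjoint edges leave uncovered *)
pose d := \sum_i a i - n.*2.
have le2n : n.*2 <= \sum_i a i.
  apply: leq_trans (cov set0) _; apply: leq_sum => i _.
  rewrite /cover_weight inE; case: existsP => [[j]|_]; rewrite ?mul1n //.
  by rewrite inE.
have [|f fI fr] := @hall_marriage _ (@padded_nbrs I e a d).
  apply: padded_hall; first exact: leq_subr.
  by move=> S; have := cov S; rewrite /d; lia.
pose g := @padded_rel I e a d.
have [E [aE uE nE]] := injective_matching fI (@linked_padded I e a d link).
rewrite -/g in aE nE.
have cT : #|padded a d| = n.*2 + d + d.
  have cC : #|clone a| = \sum_i a i by rewrite -(card_clone a predT).
  by rewrite card_sum card_ord cC; lia.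
have good : n.*2 <= #|[set t | g t (f t)]|.
  pose dummy := [set t : padded a d | if t is inr _ then true else false].
  have cD : #|dummy| <= d.
    rewrite -[leqRHS]card_ord -[leqRHS](card_imset _ (@inr_inj (clone a) _)).
    apply: subset_leq_card; apply/subsetP => -[v|k]; rewrite inE // => _.
    by apply: imset_f.
  have sub : ~: [set t | g t (f t)] \subset dummy :|: f @^-1: dummy.
    apply/subsetP => t; rewrite !inE; have := fr t; case: t => [v|k] //=.
    by rewrite /padded_nbrs inE; case: (f _) => // u ->.
  have := subset_leq_card sub; have := cardsC [set t | g t (f t)].
  have [leU _] := leq_card_setU dummy (f @^-1: dummy); rewrite cT.
  have : #|f @^-1: dummy| <= #|dummy|.
    by rewrite -(card_imset (f @^-1: dummy) fI) subset_leq_card // sub_imset_pre.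
  lia.
pose lab i := fun t : padded a d => if t is inl v then tag v == i else false.
have [F [aF sF cF]] : exists F : seq (I * I), [/\ edges_of e F, size F = size E &
    forall i, count_mem i (endpoints F) = count (lab i) (endpoints E)].
  elim: E aE {uE nE} => [|[x y] E IHE] /=; first by exists [::].
  case/andP; case: x y => [u|//] [v|//] /= uv /IHE[F [aF sF cF]].
  exists ((tag u, tag v) :: F); split; rewrite /= ?uv ?sF //.
  by move=> i; rewrite -/(endpoints _) cF.
have leF : n <= size F by rewrite sF; move: good nE; lia.
exists (take n F); split.
- by move: aF; rewrite -{1}(cat_take_drop n F) edges_of_cat => /andP[].
- exact: size_takel.
move=> i; apply: (@leq_trans (count_mem i (endpoints F))).
  by rewrite -[in leqRHS](cat_take_drop n F) endpoints_cat count_cat leq_addr.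
rewrite cF -size_filter -(card_uniqP _) ?filter_uniq //.
have <- : \sum_(j | pred1 i j) a j = a i by rewrite big_pred1_eq.
rewrite -(card_clone a (pred1 i)).
rewrite -(card_imset _ (@inl_inj (clone a) 'I_d)).
apply: subset_leq_card; apply/subsetP => t; rewrite mem_filter => /andP[+ _].
by case: t => // v vi; apply: imset_f.
Qed.

(** * Odd closed walks in graphs and in their components *)

Section Walks.
Variables (I : finType) (e : rel I).
Hypothesis e_sym : ssrbool.symmetric e.

Lemma cover_weight_edge (S : {set I}) i j :
  e i j -> 2 <= cover_weight e S i + cover_weight e S j.
Proof.
move=> eij; rewrite /cover_weight.
have h x y : e x y -> 1 <= (x \notin S) + [exists z in S, e z y].
  move=> exy; case xS: (x \in S) => //=.
  by have -> : [exists z in S, e z y] by apply/existsP; exists x; rewrite xS.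
have := h _ _ eij; have := h j i; rewrite e_sym => /(_ eij); lia.
Qed.

(** If no edge joins [w1] to [w2], each edge of [E] has both ends on [w1] or none;
    but the ends on [w1] are counted by the length of [w1], which is odd. *)
Lemma perm_cover_linked (w1 w2 : seq I) (E : seq (I * I)) :
  odd_closed_walk e w1 -> odd_closed_walk e w2 ->
  edges_of e E -> perm_eq (endpoints E) (w1 ++ w2) ->
  exists x y, [/\ x \in w1, y \in w2 & e x y].
Proof.
move=> /andP[c1 o1] /andP[c2 o2] eE pE.
have [/existsP[x /existsP[y /and3P[xw yw exy]]]|] :=
  boolP [exists x, exists y, [&& x \in w1, y \in w2 & e x y]].
  by exists x, y.
rewrite negb_exists => /forallP none.
have {}none x y : x \in w1 -> y \in w2 -> ~~ e x y.
  move=> xw yw; have := none x; rewrite negb_exists => /forallP/(_ y).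
  by rewrite xw yw.
have disj x : x \in w1 -> x \notin w2.
  move=> xw; apply/negP => xw2; have exn := next_cycle c2 xw2.
  by have := none x (next w2 x) xw; rewrite mem_next exn => /(_ xw2).
have even_cover (F : seq (I * I)) : edges_of e F ->
    {subset endpoints F <= w1 ++ w2} -> ~~ odd (count (mem w1) (endpoints F)).
  elim: F => //= -[i j] F IHF /andP[/= eij eF] sub.
  have inw z : z \in [:: i; j] -> (z \in w1) || (z \in w2).
    move=> zij; rewrite -mem_cat sub //.
    by rewrite -[X in z \in X]/([:: i; j] ++ endpoints F) mem_cat zij.
  rewrite -/(endpoints F) addnA oddD (negPf (IHF eF _)) ?addbF; last first.
    by move=> z zF; apply: sub; rewrite /endpoints /= !inE zF !orbT.
  suff -> : (i \in w1) = (j \in w1) by rewrite addnn odd_double.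
  have := inw i; have := inw j; rewrite !inE !eqxx orbT => /(_ erefl) jw /(_ erefl) iw.
  apply/idP/idP => [i1|j1].
    by case/orP: jw => // /(none _ _ i1); rewrite eij.
  by case/orP: iw => // /(none _ _ j1); rewrite e_sym eij.
have := even_cover E eE; rewrite (permP pE) count_cat.
have -> : count (mem w1) w1 = size w1 by apply/eqP; rewrite -all_count; apply/allP.
have -> : count (mem w1) w2 = 0.
  apply/eqP; rewrite eqn0Ngt -has_count; apply/hasPn => x x2 /=.
  by apply/negP => /disj; rewrite x2.
rewrite addn0 o1 => h; have // : false by apply: h => z; rewrite (perm_mem pE).
Qed.

Lemma closed_walk_arcs (w : seq I) : cycle e w ->
  exists E : seq (I * I),
  [/\ edges_of e E, size E = size w & perm_eq (endpoints E) (w ++ w)].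
Proof.
case: w => [|x p] cyc; first by exists [::].
have walk y q : path e y q -> exists E : seq (I * I),
    [/\ edges_of e E, size E = size q &
        perm_eq (last y q :: endpoints E) (y :: q ++ q)].
  elim: q y => [|z q IHq] y /=; first by exists [::].
  case/andP => eyz /IHq[E [eE sE pE]]; exists ((y, z) :: E).
  split; rewrite /= ?eyz ?sE //.
  have -> : last z q :: [:: y, z & flatten [seq [:: p0.1; p0.2] | p0 <- E]] =
    [:: last z q] ++ [:: y; z] ++ endpoints E by [].
  rewrite perm_catCA /= perm_cons perm_cons.
  by rewrite (permPl pE) -cat1s perm_catCA.
have [E [eE sE pE]] := walk x (rcons p x) cyc; exists E.
rewrite sE size_rcons; split=> //; rewrite last_rcons perm_cons in pE.
by rewrite (permPl pE); apply: perm_cat; rewrite perm_rcons.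
Qed.

End Walks.

Section Components.
Variables (s : nat) (G : sgraph s).
Implicit Types (C : {set 'I_s}) (w : seq 'I_s).

Lemma bipartite_walk (H : rel 'I_s) (A : {set 'I_s}) x p :
    (forall i j, H i j -> (i \in A) != (j \in A)) ->
  path H x p -> (last x p \in A) = (x \in A) (+) odd (size p).
Proof.
move=> bip; elim: p x => [|y p IHp] x /=; first by rewrite addbF.
case/andP=> /bip xy /IHp ->; rewrite addbN -addNb; congr (_ (+) _).
by case: (x \in A) xy; case: (y \in A).
Qed.

Lemma odd_walk_not_bipartite (H : sgraph s) w :
  odd_closed_walk H w -> ~~ bipartite H.
Proof.
case/andP; case: w => // x p cyc od; apply/negP => /existsP[A /forallP bip].
have {}bip i j : H i j -> (i \in A) != (j \in A).
  by have /forallP/(_ j)/implyP := bip i.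
have := bipartite_walk bip cyc; rewrite last_rcons size_rcons.
by move: od => /= ->; case: (x \in A).
Qed.

Lemma componentsP C :
  reflect (exists r, C = [set x | connect G r x]) (C \in components G).
Proof.
apply: (iffP imsetP) => [[r _ ->]|[r ->]]; exists r => //;
  by apply/setP => x; rewrite !inE.
Qed.

Lemma connect_adj_sym : connect_sym G.
Proof. exact/sym_connect_sym/adj_sym. Qed.

Lemma odd_walk_induced C w x : odd_closed_walk G w -> x \in w ->
  C = [set y | connect G x y] -> odd_closed_walk (induced G C) w.
Proof.
case/andP=> cyc od xw defC; rewrite /odd_closed_walk od andbT.
apply: (sub_in_cycle (P := mem C) (e := G)) => //.
  by move=> i j /= iC jC ij; rewrite /induced_adj iC jC.
apply/allP => y yw; change (y \in C); rewrite defC inE.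
have := rot_index xw; set p := _ ++ _ => def_w.
rewrite -(rot_cycle (index x w)) def_w in cyc.
by apply: (path_connect cyc); rewrite -rcons_cons mem_rcons inE -def_w mem_rot yw orbT.
Qed.

Lemma induced_odd_walk C w : odd_closed_walk (induced G C) w ->
  odd_closed_walk G w /\ {subset w <= C}.
Proof.
case/andP=> cyc od; split; last first.
  by move=> x xw; have /and3P[] := next_cycle cyc xw.
by rewrite /odd_closed_walk od andbT; apply: sub_cycle cyc => i j /and3P[].
Qed.

(** In the bipartite double cover [D], the vertices reached from the root [r] on its
    own sheet form a candidate colour class.  An edge that it fails to separate
    joins two vertices reached on the same sheet, that is by walks of equal parity,
    and these close up into an odd walk. *)
Lemma nonbipartite_odd_walk C : C \in components G ->
  ~~ bipartite (induced G C) -> exists w, odd_closed_walk (induced G C) w.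
Proof.
move=> /componentsP[r defC] nbip; set H := induced G C in nbip *.
pose D : rel ('I_s * bool) := fun p q => H p.1 q.1 && (p.2 != q.2).
have D_sym : ssrbool.symmetric D.
  by move=> p q; rewrite /D adj_sym eq_sym.
have walk p q : connect D p q -> exists t : seq 'I_s,
    [/\ path H p.1 t, last p.1 t = q.1 & odd (size t) = p.2 (+) q.2].
  case/connectP => t pt ->; exists (map fst t); rewrite size_map.
  elim: t p pt => [|y t IHt] p /=; first by rewrite addbb.
  case/andP=> /andP[Hpy ne] /IHt[pt lt ot]; split=> //; first exact/andP.
  rewrite ot.
  by move: ne; case: p.2 y.2 (last y t).2 => [] [] [].
have walk_reach t x : path G x t -> x \in C ->
    (exists b, connect D (r, false) (x, b)) ->
    exists b, connect D (r, false) (last x t, b).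
  elim: t x => //= y t IHt x /andP[xy pt] xC [b rx].
  have yC : y \in C.
    move: xC; rewrite defC !inE => h; exact: connect_trans h (connect1 xy).
  apply: IHt => //; exists (~~ b); apply: connect_trans rx (connect1 _).
  by rewrite /D /= /induced_adj xC yC xy; case: (b).
have reach v : v \in C -> exists b, connect D (r, false) (v, b).
  rewrite {1}defC inE => /connectP[t pt ->]; apply: walk_reach pt _ _.
    by rewrite defC inE connect0.
  by exists false; apply: connect0.
pose A := [set v | connect D (r, false) (v, false)].
move: nbip; rewrite negb_exists => /forallP/(_ A); rewrite negb_forall.
case/existsP=> i; rewrite negb_forall => /existsP[j].
rewrite negb_imply negbK => /andP[Hij /eqP sameA].
have /and3P[iC jC _] := Hij.
have [b ri rj] : exists2 b, connect D (r, false) (i, b) & connect D (r, false) (j, b).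
  have [iA|iA] := boolP (i \in A).
    by exists false; [move: iA | move: iA; rewrite sameA]; rewrite inE.
  have jA : j \notin A by rewrite -sameA.
  exists true.
    by have [[] //] := reach i iC; move: iA; rewrite inE => /negPf ->.
  by have [[] //] := reach j jC; move: jA; rewrite inE => /negPf ->.
rewrite (sym_connect_sym D_sym) in rj.
have [p [/= pp lp op]] := walk _ _ ri; have [q [/= pq lq oq]] := walk _ _ rj.
have : path H r (p ++ j :: q) by rewrite cat_path pp lp /=; apply/andP.
have : last r (p ++ j :: q) = r by rewrite last_cat.
have : odd (size (p ++ j :: q)).
  by rewrite size_cat /= oddD /= op oq; case: (b).
case/lastP: (p ++ j :: q) => // t z; rewrite last_rcons size_rcons => ot -> pt.
by exists (r :: t); rewrite /odd_closed_walk /= pt.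
Qed.

(** An edge never joins walks of two components, and an edge between two walks of one
    component survives in the subgraph induced on it. *)
Lemma linked_components :
  linked_odd_walks G <->
  (#|[set C in components G | ~~ bipartite (induced G C)]| <= 1) /\
  (forall C : {set 'I_s}, C \in components G -> ~~ bipartite (induced G C) ->
     linked_odd_walks (induced G C)).
Proof.
split=> [link|[one link] w1 w2 o1 o2].
  split=> [|C _ _ w1 w2 o1 o2].
    apply/card_le1_eqP => C1 C2; rewrite !inE => /andP[c1 n1] /andP[c2 n2].
    have [w1 /induced_odd_walk[o1 s1]] := nonbipartite_odd_walk c1 n1.
    have [w2 /induced_odd_walk[o2 s2]] := nonbipartite_odd_walk c2 n2.
    have [x [y [/s1 + /s2 + xy]]] := link _ _ o1 o2.
    case/componentsP: c1 c2 {n1 n2 s1 s2} => r1 -> /componentsP[r2 ->].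
    rewrite !inE => r1x r2y; apply/setP => z; rewrite !inE.
    have r12 : connect G r1 r2.
      apply: connect_trans r1x _; apply: connect_trans (connect1 xy) _.
      by rewrite connect_adj_sym.
    by rewrite (same_connect connect_adj_sym r12).
  have [/induced_odd_walk[{}o1 s1] /induced_odd_walk[{}o2 s2]] := (o1, o2).
  have [x [y [xw yw xy]]] := link _ _ o1 o2.
  by exists x, y; rewrite /= /induced_adj s1 ?s2.
have mem_comp w : odd_closed_walk G w -> exists2 C, odd_closed_walk (induced G C) w &
    C \in [set C in components G | ~~ bipartite (induced G C)].
  move=> ow; have : exists x, x \in w.
    by case: w ow => [/andP[]//|x w] _; exists x; rewrite inE eqxx.
  case=> x xw; pose C := [set y | connect G x y]; exists C.
    exact: odd_walk_induced xw _.
  rewrite inE; apply/andP; split; first by apply/componentsP; exists x.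
  by apply: (@odd_walk_not_bipartite _ w); apply: odd_walk_induced xw _.
have [C1 i1 c1] := mem_comp _ o1; have [C2 i2 c2] := mem_comp _ o2.
have eC := card_le1_eqP one _ _ c1 c2; subst C2.
move: c1; rewrite inE => /andP[c1 n1].
have [x [y [xw yw /and3P[_ _ xy]]]] := link _ c1 n1 _ _ i1 i2.
by exists x, y.
Qed.

End Components.

Local Open Scope ring_scope.

(** * Ideals, integral closure and orders of vanishing *)

Section Ideals.
Variable A : comNzRingType.
Implicit Types (X I : set A).

(** Combinations indexed by ordinals are awkward to split; this principle replaces
    them by closure properties. *)
Lemma ideal_gen_ind X (P : A -> Prop) :
    P 0 -> (forall f g, P f -> P g -> P (f + g)) ->
    (forall c x, X x -> P (c * x)) -> forall f, ideal_gen X f -> P f.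
Proof.
move=> P0 PD PM f [n [c [g [Xg ->]]]].
by elim/big_ind: _ => // i _; apply: PM.
Qed.

Lemma ideal_gen_mul X c x : X x -> ideal_gen X (c * x).
Proof.
by move=> Xx; exists 1%N, (fun=> c), (fun=> x); rewrite big_ord1.
Qed.

Lemma ideal_gen0 X : ideal_gen X 0.
Proof.
exists 0%N, (fun=> 0), (fun=> 0); rewrite big_ord0; split=> //.
by case.
Qed.

Lemma ideal_genD X f g : ideal_gen X f -> ideal_gen X g -> ideal_gen X (f + g).
Proof.
move=> [n [c [x [Xx ->]]]] [m [d [y [Xy ->]]]].
pose glue (T : Type) (u : 'I_n -> T) (v : 'I_m -> T) (i : 'I_(n + m)) :=
  match split i with inl j => u j | inr k => v k end.
have gl T (u : 'I_n -> T) v i : glue T u v (lshift m i) = u i.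
  by rewrite /glue (unsplitK (inl i)).
have gr T (u : 'I_n -> T) v i : glue T u v (rshift n i) = v i.
  by rewrite /glue (unsplitK (inr i)).
exists (n + m)%N, (glue _ c d), (glue _ x y); split.
  by move=> i; rewrite /glue; case: (split i).
by rewrite big_split_ord /=; congr (_ + _); apply: eq_bigr => i _;
  rewrite ?gl ?gr.
Qed.

Lemma ideal_gen_sum X (T : eqType) (r : seq T) (F : T -> A) :
  (forall t, t \in r -> ideal_gen X (F t)) -> ideal_gen X (\sum_(t <- r) F t).
Proof.
move=> XF; rewrite big_seq; elim/big_ind: _ => //; first exact: ideal_gen0.
exact: ideal_genD.
Qed.

(** The equation [f - f = 0], of degree one. *)
Lemma ideal_gen_sub_closure X f :
  ideal_gen X f -> integral_closure (ideal_gen X) f.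
Proof.
move=> Xf; exists 1%N, (fun=> - f); split=> //; last first.
  by rewrite big_nat1 expr1 expr0 mulr1 subrr.
move=> [|[|i]] //= _; rewrite -mulN1r; apply: ideal_gen_mul.
by exists (fun=> f); rewrite big_ord1.
Qed.

Lemma sqr_in_closure I f : ideal_pow I 2 (f ^+ 2) -> integral_closure I f.
Proof.
move=> If; exists 2%N, (fun i => if i == 2%N then - f ^+ 2 else 0); split=> //.
  move=> [|[|[|i]]] //= _; first exact: ideal_gen0.
  apply: (@ideal_gen_ind _ (fun x => ideal_pow I 2 (- x)) _ _ _ _ If).
  - by rewrite oppr0; apply: ideal_gen0.
  - by move=> x y Ix Iy; rewrite opprD; apply: ideal_genD.
  - by move=> c x Ix; rewrite -mulNr; apply: ideal_gen_mul.
by rewrite big_nat_recl // big_nat1 /= mul0r add0r expr0 mulr1 subrr.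
Qed.

Section Order.
Variables (B : comNzRingType) (phi : {rmorphism A -> B}).

Lemma ideal_gen_multiple X d : (forall x, X x -> exists q, phi x = q * d) ->
  forall f, ideal_gen X f -> exists q, phi f = q * d.
Proof.
move=> Xd; apply: ideal_gen_ind => [|f g [p pf] [q qg]|c x /Xd[q qx]].
- by exists 0; rewrite rmorph0 mul0r.
- by exists (p + q); rewrite rmorphD /= mulrDl pf qg.
- by exists (phi c * q); rewrite rmorphM /= qx mulrA.
Qed.

Lemma ideal_pow_multiple I d n : (forall x, I x -> exists q, phi x = q * d) ->
  forall f, ideal_pow I n f -> exists q, phi f = q * d ^+ n.
Proof.
move=> Id; apply: ideal_gen_multiple => _ [g [Ig ->]].
rewrite rmorph_prod -[X in d ^+ X]card_ord -prodr_const.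
elim/big_rec2: _ => [|i y1 y2 _ [q ->]]; first by exists 1; rewrite mulr1.
by have [p ->] := Id _ (Ig i); exists (p * q); rewrite mulrACA.
Qed.
End Order.

(** The [X]-adic order [j] of [phi f] is a valuation: if it were less than [k], then
    [phi f ^+ m] would have order [j * m] while every other term of the integral
    equation has a larger one. *)
Lemma closure_multiple (D : idomainType) (phi : {rmorphism A -> {poly D}}) I k f :
    (forall x, I x -> exists q, phi x = q * 'X^k) ->
  integral_closure I f -> exists q, phi f = q * 'X^k.
Proof.
move=> Ik [m [a [m_gt0 Ia eqn]]].
have [phif0|nz] := eqVneq (phi f) 0; first by exists 0; rewrite mul0r.
have [j [g]] := multiplicity_XsubC (phi f) 0.
rewrite nz subr0 /= => g0 def_f.
have [lekj|ltjk] := leqP k j.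
  by exists (g * 'X^(j - k)); rewrite -mulrA -exprD subnK.
have [h def_h] : exists h, \sum_(1 <= i < m.+1) phi (a i) * phi f ^+ (m - i)
    = h * 'X^((j * m).+1).
  rewrite big_nat; elim/big_rec: _ => [|i y /andP[i0 im] [h ->]].
    by exists 0; rewrite mul0r.
  have [|q ->] := ideal_pow_multiple Ik (Ia i _); first by rewrite i0.
  have le_exp : ((j * m).+1 <= k * i + j * (m - i))%N.
    have : (j.+1 * i <= k * i)%N by rewrite leq_mul2r ltjk orbT.
    have : (j * i <= j * m)%N by rewrite leq_mul2l orbC -ltnS im.
    by rewrite mulSn mulnBr; lia.
  exists (q * g ^+ (m - i) * 'X^(k * i + j * (m - i) - (j * m).+1) + h).
  rewrite mulrDl -(mulrA _ 'X^_ 'X^_) -exprD subnK // exprD def_f exprMn -!exprM.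
  by rewrite mulrACA.
have := congr1 phi eqn; rewrite rmorphD rmorph_sum rmorph0 /=.
under eq_bigr do rewrite rmorphM rmorphXn.
rewrite rmorphXn /= def_h def_f exprMn -exprM exprS !mulrA -mulrDl => /eqP.
rewrite mulf_eq0 expf_eq0 polyX_eq0 andbF orbF => /eqP gh.
case/negP: g0; have := congr1 (horner^~ 0) gh.
by rewrite !hornerE => /eqP; rewrite expf_eq0 m_gt0.
Qed.

End Ideals.

Section WeightedOrder.
Variables (K : fieldType) (s : nat) (z : 'I_s -> nat).

(** The substitution [t_i |-> t_i u^(z_i)]: the coefficient of [u^k] is the component
    of weight [k], so the [u]-adic order is the least weight of a monomial. *)
Definition grade : {mpoly K[s]} -> {poly {mpoly K[s]}} :=
  mmap (polyC \o @mpolyC s K) (fun i => ('X_i)%:P * 'X^(z i)).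

HB.instance Definition _ := GRing.RMorphism.on grade.

Lemma gradeX (m : 'X_{1..s}) :
  grade 'X_[m] = ('X_[m])%:P * 'X^(\sum_i z i * m i)%N.
Proof.
rewrite /grade mmapX /mmap1 [X in X%:P]mpolyXE_id rmorph_prod -prodrXr -big_split /=.
by apply: eq_bigr => i _; rewrite exprMn rmorphXn exprM.
Qed.

Lemma coef_grade (f : {mpoly K[s]}) k m :
  (grade f)`_k@_m = if (\sum_i z i * m i)%N == k then f@_m else 0.
Proof.
have -> : grade f = \sum_(t <- msupp f)
    (f@_t *: 'X_[t])%:P * 'X^(\sum_i z i * t i)%N.
  rewrite {1}(mpolyE f) rmorph_sum /=; apply: eq_bigr => t _.
  rewrite -mul_mpolyC rmorphM /= gradeX {1}/grade mmapC /= mulrA -rmorphM /=.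
  by rewrite mul_mpolyC.
rewrite coef_sum raddf_sum /=.
pose b := (\sum_i z i * m i)%N == k.
transitivity (b%:R * f@_m); last by rewrite /b; case: eqP; rewrite ?mul1r ?mul0r.
rewrite [f in RHS]mpolyE raddf_sum mulr_sumr; apply: eq_bigr => t _ /=.
rewrite coefCM coefXn eq_sym mulr_natr raddfMn /= mcoeffZ mcoeffX /b.
by have [->|] := eqVneq t m; rewrite ?mulr0 ?mul0rn // mulr1 mulr_natl.
Qed.

Lemma grade_multiple_supp f k m :
    (exists q, grade f = q * 'X^k) -> m \in msupp f ->
  (k <= \sum_i z i * m i)%N.
Proof.
move=> [q def_f] mf; rewrite leqNgt; apply/negP => ltk.
have := coef_grade f (\sum_i z i * m i) m.
by rewrite def_f coefMXn ltk mcoeff0 eqxx => /esym/eqP; rewrite mcoeff_eq0 mf.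
Qed.

Lemma grade_supp_multiple f k :
    (forall m, m \in msupp f -> (k <= \sum_i z i * m i)%N) ->
  exists q, grade f = q * 'X^k.
Proof.
move=> fk; rewrite {1}(mpolyE f) rmorph_sum /= big_seq.
elim/big_rec: _ => [|t g tf [q ->]]; first by exists 0; rewrite mul0r.
have le := fk t tf.
exists (grade (f@_t)%:MP * ('X_[t])%:P * 'X^(\sum_i z i * t i - k)%N + q).
by rewrite mulrDl -(mulrA _ 'X^_ 'X^_) -exprD subnK // -mul_mpolyC rmorphM /= gradeX mulrA.
Qed.
End WeightedOrder.

(** * Powers of the edge ideal *)

Section EdgeIdeal.
Variables (K : fieldType) (s : nat) (G : sgraph s).
Notation I := 'I_s.

(** Sums of edges and visits of walks are both exponents of this form, so that
    identities between them become identities of multisets. *)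
Definition walk_mnm (w : seq I) : 'X_{1..s} := [multinom count_mem i w | i < s].

Lemma walk_mnmE w i : walk_mnm w i = count_mem i w.
Proof. exact: mnmE. Qed.

Lemma walk_mnm_nil : walk_mnm [::] = 0%MM.
Proof. by apply/mnmP => i; rewrite walk_mnmE. Qed.

Lemma walk_mnm_cat (w1 w2 : seq I) :
  walk_mnm (w1 ++ w2) = (walk_mnm w1 + walk_mnm w2)%MM.
Proof. by apply/mnmP => i; rewrite mnmDE !walk_mnmE count_cat. Qed.

Lemma walk_mnm1 i : walk_mnm [:: i] = U_(i)%MM.
Proof. by apply/mnmP => j; rewrite mnm1E walk_mnmE /= addn0. Qed.

Lemma walk_mnm_perm (w1 w2 : seq I) : perm_eq w1 w2 -> walk_mnm w1 = walk_mnm w2.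
Proof. by move/permP => p; apply/mnmP => i; rewrite !walk_mnmE p. Qed.

Lemma edge_mnm (p : I * I) :
  'X_[walk_mnm [:: p.1; p.2]] = 'X_p.1 * 'X_p.2 :> {mpoly K[s]}.
Proof. by rewrite -(cat1s p.1) walk_mnm_cat !walk_mnm1 mpolyXD. Qed.

Lemma walk_mnm_endpoints (E : seq (I * I)) :
  'X_[walk_mnm (endpoints E)] = \prod_(p <- E) ('X_p.1 * 'X_p.2) :> {mpoly K[s]}.
Proof.
elim: E => [|p E IHE]; first by rewrite big_nil walk_mnm_nil mpolyX0.
by rewrite big_cons -IHE -(cat1s p) endpoints_cat walk_mnm_cat mpolyXD edge_mnm.
Qed.

Lemma perm_eq_count_le (w1 w2 : seq I) : size w1 = size w2 ->
  (forall i, (count_mem i w1 <= count_mem i w2)%N) -> perm_eq w1 w2.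
Proof.
move=> sz /count_subseqP[w sub pw]; suff <- : w = w2 by [].
by apply/eqP; rewrite -(size_subseq_leqif sub) -(perm_size pw) sz.
Qed.

Lemma edges_in_pow (E : seq (I * I)) (m : 'X_{1..s}) :
    edges_of G E -> (walk_mnm (endpoints E) <= m)%MM ->
  ideal_pow (edge_ideal K G) (size E) 'X_[m].
Proof.
move=> eE le; rewrite -(submK le) mpolyXD; apply: ideal_gen_mul.
exists (fun i => 'X_(tnth (in_tuple E) i).1 * 'X_(tnth (in_tuple E) i).2); split.
  move=> i; rewrite -[X in edge_ideal K G X]mul1r; apply: ideal_gen_mul.
  exists (tnth (in_tuple E) i).1, (tnth (in_tuple E) i).2; split=> //.
  exact: (allP eE _ (mem_tnth i (in_tuple E))).
by rewrite walk_mnm_endpoints big_tnth.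
Qed.

(** Membership in a monomial ideal is read off the support. *)
Lemma ideal_gen_supp (X : set {mpoly K[s]}) (P : 'X_{1..s} -> Prop) :
    (forall m t, P m -> P (t + m)%MM) ->
    (forall x m, X x -> m \in msupp x -> P m) ->
  forall f m, ideal_gen X f -> m \in msupp f -> P m.
Proof.
move=> Pup XP f m Xf; move: m.
apply: (@ideal_gen_ind _ X (fun f => forall m, m \in msupp f -> P m) _ _ _ f Xf).
- by move=> m; rewrite msupp0.
- by move=> g h gP hP m /msuppD_le; rewrite mem_cat => /orP[/gP|/hP].
move=> c x Xx m /msuppM_le/allpairsP[[t1 t2] /= [_ t2x ->]].
by apply: Pup; apply: XP Xx t2x.
Qed.

Lemma pow_supp n f m : ideal_pow (edge_ideal K G) n f -> m \in msupp f ->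
  exists E : seq (I * I), [/\ edges_of G E, size E = n &
    (walk_mnm (endpoints E) <= m)%MM].
Proof.
pose P k m := exists E : seq (I * I), [/\ edges_of G E, size E = k &
    (walk_mnm (endpoints E) <= m)%MM].
have Pup k t u : P k t -> P k (u + t)%MM.
  move=> [E [eE sE le]]; exists E; split=> //.
  exact: lepm_trans le (lem_addl _ _).
apply: (ideal_gen_supp (P := P n)); first exact: Pup.
move=> _ t [g [Ig ->]]; elim: n t g Ig => [|k IHk] t g Ig.
  rewrite big_ord0 msupp1 inE => _; exists [::]; split=> //.
  by rewrite walk_mnm_nil; apply/mnm_lepP => i; rewrite mnm0E.
rewrite big_ord_recl => /msuppM_le/allpairsP[[t1 t2] /= [h1 h2 ->]].
have [E2 [e2 s2 le2]] := IHk _ _ (fun i => Ig (lift ord0 i)) h2.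
have [E1 [e1 s1 le1]] : P 1%N t1.
  apply: (ideal_gen_supp (P := P 1%N)) (Ig ord0) h1; first exact: Pup.
  move=> _ u [i [j [Gij ->]]]; have /= <- := edge_mnm (i, j).
  rewrite msuppX inE => /eqP ->; exists [:: (i, j)]; split=> //=.
    by rewrite Gij.
  exact: lepm_refl.
exists (E1 ++ E2); rewrite edges_of_cat e1 e2 size_cat s1 s2; split=> //.
rewrite endpoints_cat walk_mnm_cat; apply/mnm_lepP => i.
by rewrite !mnmDE leq_add // (mnm_lepP _).
Qed.

Lemma cover_weight_order f (S : {set I}) : edge_ideal K G f ->
  exists q, grade (cover_weight G S) f = q * 'X^2.
Proof.
apply: ideal_gen_multiple => _ [i [j [Gij ->]]].
apply: grade_supp_multiple => t.
rewrite -mpolyXD msuppX inE => /eqP ->.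
under eq_bigr do rewrite mnmDE !mnm1E mulnDr.
rewrite big_split /=.
have sum1 k : (\sum_l cover_weight G S l * (k == l) = cover_weight G S k)%N.
  by rewrite (bigD1 k) //= eqxx muln1 big1 ?addn0 // => l /negPf;
    rewrite eq_sym => ->; rewrite muln0.
by rewrite !sum1; apply: cover_weight_edge Gij; apply: adj_sym.
Qed.

(** A valuative bound on the Newton polyhedron: every monomial of [f] has weight at
    least [2 n] for each cover, although [f] itself need not be a monomial. *)
Lemma cover_weight_supp n f m (S : {set I}) :
    integral_closure (ideal_pow (edge_ideal K G) n) f -> m \in msupp f ->
  (n.*2 <= \sum_i cover_weight G S i * m i)%N.
Proof.
move=> clf; apply: grade_multiple_supp; apply: closure_multiple clf => x Ix.
have [q ->] := ideal_pow_multiple (fun f => @cover_weight_order f S) Ix.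
by exists q; rewrite -exprM mul2n.
Qed.

(** Each monomial of [f] satisfies the inequalities of the packing theorem, hence is
    divisible by a product of [n] edges. *)
Lemma linked_normal : linked_odd_walks G -> normal_ideal (edge_ideal K G).
Proof.
move=> link n _; apply/seteqP; split=> [f|f clf]; first exact: ideal_gen_sub_closure.
rewrite (mpolyE f); apply: ideal_gen_sum => m mf.
rewrite -mul_mpolyC -[ideal_gen _]/(ideal_pow (edge_ideal K G) n).
have [E [eE sE cE]] := linked_packing link (fun S => cover_weight_supp S clf mf).
have : ideal_pow (edge_ideal K G) n 'X_[m].
  rewrite -sE; apply: edges_in_pow => //.
  by apply/mnm_lepP => i; rewrite walk_mnmE.
apply: (@ideal_gen_ind _ _ (fun x => ideal_pow _ n (_ * x))).
- by rewrite mulr0; apply: ideal_gen0.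
- by move=> x y xI yI; rewrite mulrDr; apply: ideal_genD.
- by move=> c x Xx; rewrite mulrA; apply: ideal_gen_mul.
Qed.

(** The arcs of two odd closed walks cover each visit twice, from both sides: half of
    this is a fractional cover by [n] edges. *)
Lemma odd_walks_arcs (w1 w2 : seq I) :
    odd_closed_walk G w1 -> odd_closed_walk G w2 ->
  exists n E, [/\ (0 < n)%N, size (w1 ++ w2) = n.*2, edges_of G E, size E = n.*2 &
    perm_eq (endpoints E) ((w1 ++ w2) ++ (w1 ++ w2))].
Proof.
move=> /andP[c1 o1] /andP[c2 o2].
have [E1 [e1 s1 p1]] := closed_walk_arcs c1.
have [E2 [e2 s2 p2]] := closed_walk_arcs c2.
exists (size (w1 ++ w2))./2, (E1 ++ E2).
have even : (size (w1 ++ w2))./2.*2 = size (w1 ++ w2).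
  by have := odd_double_half (size (w1 ++ w2)); rewrite size_cat oddD o1 o2.
rewrite even; split=> //.
- by rewrite -double_gt0 even size_cat; case: (size w1) o1.
- by rewrite edges_of_cat e1.
- by rewrite !size_cat s1 s2.
rewrite endpoints_cat (permPl (perm_cat p1 p2)) -!catA perm_cat2l.
by rewrite perm_catCA.
Qed.

(** The monomial of the visits is integral over the [n]-th power since its square is
    the product of the [2 n] arcs, split into two products of [n]. *)
Lemma normal_linked : normal_ideal (edge_ideal K G) -> linked_odd_walks G.
Proof.
move=> normal w1 w2 o1 o2.
have [n [E [n_gt0 sw eE sE pE]]] := odd_walks_arcs o1 o2.
pose J := ideal_pow (edge_ideal K G) n.
have : integral_closure J 'X_[walk_mnm (w1 ++ w2)].
  apply: sqr_in_closure.
  rewrite expr2 -mpolyXD -walk_mnm_cat -(walk_mnm_perm pE).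
  rewrite -(cat_take_drop n E) endpoints_cat walk_mnm_cat mpolyXD -[X in ideal_pow _ _ X]mul1r.
  apply: ideal_gen_mul.
  exists (fun i : 'I_2 => 'X_[walk_mnm (endpoints (if i == ord0 then take n E else drop n E))]).
  split; last by rewrite big_ord_recl big_ord1.
  have [eT eD] : edges_of G (take n E) /\ edges_of G (drop n E).
    by move: eE; rewrite -{1}(cat_take_drop n E) edges_of_cat => /andP.
  have sT : size (take n E) = n by rewrite size_takel // sE -addnn leq_addr.
  have sD : size (drop n E) = n by rewrite size_drop sE -addnn addnK.
  move=> i; rewrite /J; case: ifP => _.
    by rewrite -{1}sT; apply: edges_in_pow => //; apply: lepm_refl.
  by rewrite -{1}sD; apply: edges_in_pow => //; apply: lepm_refl.
rewrite -(normal n n_gt0) => inI.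
have [|F [eF sF /mnm_lepP le]] := pow_supp (m := walk_mnm (w1 ++ w2)) inI.
  by rewrite msuppX inE.
apply: perm_cover_linked o1 o2 eF _; first exact: adj_sym.
apply: perm_eq_count_le; first by rewrite size_endpoints sF sw.
by move=> i; have := le i; rewrite !walk_mnmE.
Qed.
End EdgeIdeal.

(** * The edge subring and the Ehrhart ring *)

Section Subalgebra.
Variables (K : fieldType) (B : algType K).
Implicit Types X Y : set B.

Lemma subalgebra_gen_min X Y :
    Y 1 -> (forall c u v, Y u -> Y v -> Y (c *: u + v)) ->
    (forall u v, Y u -> Y v -> Y (u * v)) -> (X `<=` Y)%classic ->
  (subalgebra_gen X `<=` Y)%classic.
Proof.
move=> Y1 YL YM XY f; apply; split=> //; split.
- by rewrite classical_sets.in_setE.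
- by move=> c u v; rewrite !classical_sets.in_setE; apply: YL.
- by move=> u v; rewrite !classical_sets.in_setE; apply: YM.
Qed.

Lemma subalgebra_gen_closed X : GRing.subalg_closed (mem (subalgebra_gen X)).
Proof.
split.
- by rewrite classical_sets.in_setE => Y [[+ _ _] _]; rewrite classical_sets.in_setE.
- move=> c u v; rewrite !classical_sets.in_setE => Xu Xv Y XY.
  have [[_ YL _] _] := XY.
  by have := YL c u v; rewrite !classical_sets.in_setE; apply; [apply: Xu | apply: Xv].
- move=> u v; rewrite !classical_sets.in_setE => Xu Xv Y XY.
  have [[_ _ YM] _] := XY.
  by have := YM u v; rewrite !classical_sets.in_setE; apply; [apply: Xu | apply: Xv].
Qed.

Lemma subalgebra_gen_mem X : (X `<=` subalgebra_gen X)%classic.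
Proof. by move=> f Xf Y [_]; apply. Qed.

Lemma subalgebra_gen_sub X Y :
  (X `<=` subalgebra_gen Y)%classic ->
  (subalgebra_gen X `<=` subalgebra_gen Y)%classic.
Proof.
move=> XY; have [Y1 YL YM] := subalgebra_gen_closed Y.
apply: subalgebra_gen_min => //; first by rewrite classical_sets.in_setE in Y1.
- by move=> c u v; have := YL c u v; rewrite !classical_sets.in_setE.
- by move=> u v; have := YM u v; rewrite !classical_sets.in_setE.
Qed.

Lemma subalgebra_gen_prod X (T : eqType) (r : seq T) (F : T -> B) :
  (forall t, t \in r -> X (F t)) -> subalgebra_gen X (\prod_(t <- r) F t).
Proof.
have [Y1 YL YM] := subalgebra_gen_closed X.
move=> XF; rewrite big_seq; elim/big_ind: _ => //.
- by rewrite classical_sets.in_setE in Y1.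
- by move=> u v; have := YM u v; rewrite !classical_sets.in_setE.
- by move=> t /XF; apply: subalgebra_gen_mem.
Qed.
End Subalgebra.

Section Polytope.
Variables (R : realType) (s : nat) (G : sgraph s).

Lemma vec_of_mnmD (a b : 'X_{1..s}) :
  vec_of_mnm R (a + b)%MM = vec_of_mnm R a + vec_of_mnm R b.
Proof. by apply/rowP => i; rewrite !mxE mnmDE natrD. Qed.

Lemma vec_of_mnm1 (i : 'I_s) : vec_of_mnm R U_(i)%MM = unit_vec R i.
Proof. by apply/rowP => j; rewrite !mxE mnm1E eqxx eq_sym. Qed.

Lemma vec_of_endpoints (E : seq ('I_s * 'I_s)) :
  vec_of_mnm R (walk_mnm (endpoints E)) =
  \sum_(p <- E) (unit_vec R p.1 + unit_vec R p.2).
Proof.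
elim: E => [|p E IHE].
  by rewrite big_nil; apply/rowP => i; rewrite !mxE walk_mnmE.
rewrite big_cons -IHE -(cat1s p) endpoints_cat walk_mnm_cat vec_of_mnmD.
by rewrite -[endpoints [:: p]]/([:: p.1] ++ [:: p.2]) walk_mnm_cat !walk_mnm1
  vec_of_mnmD !vec_of_mnm1.
Qed.

(** Equal weights are enough to place both single edges and covers by the arcs of odd
    walks in dilates of the polytope. *)
Lemma edge_barycenter (E : seq ('I_s * 'I_s)) : edges_of G E -> (0 < size E)%N ->
  edge_polytope R G ((size E)%:R^-1 *: vec_of_mnm R (walk_mnm (endpoints E))).
Proof.
move=> eE E_gt0; have nz : (size E)%:R != 0 :> R by rewrite pnatr_eq0 -lt0n.
exists (size E), (fun=> (size E)%:R^-1),
  (fun i => unit_vec R (tnth (in_tuple E) i).1 + unit_vec R (tnth (in_tuple E) i).2).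
split.
- by move=> i; rewrite invr_ge0 ler0n.
- by rewrite sumr_const card_ord -[LHS]mulr_natr mulVf.
- move=> i; exists (tnth (in_tuple E) i).1, (tnth (in_tuple E) i).2; split=> //.
  exact: (allP eE _ (mem_tnth i (in_tuple E))).
- by rewrite vec_of_endpoints big_tnth scaler_sumr.
Qed.

Lemma half_cover_dilate n (E : seq ('I_s * 'I_s)) (w : seq 'I_s) :
    (0 < n)%N -> edges_of G E -> size E = n.*2 -> perm_eq (endpoints E) (w ++ w) ->
  dilate n (edge_polytope R G) (vec_of_mnm R (walk_mnm w)).
Proof.
move=> n_gt0 eE sE pE; have := edge_barycenter eE; rewrite sE double_gt0 => /(_ n_gt0) inP.
apply: (ex_intro2 _ _ _ inP); rewrite (walk_mnm_perm pE) walk_mnm_cat vec_of_mnmD.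
have nz : n%:R != 0 :> R by rewrite pnatr_eq0 -lt0n.
rewrite -mulr2n -scaler_nat !scalerA -muln2 natrM invfM mulrA mulfV // mul1r.
by rewrite mulVf ?scale1r // pnatr_eq0.
Qed.

Lemma edge_dilate i j : G i j ->
  dilate 1 (edge_polytope R G) (vec_of_mnm R (walk_mnm [:: i; j])).
Proof.
move=> Gij; have := @edge_barycenter [:: (i, j)]; rewrite /= Gij => /(_ erefl erefl) inP.
by apply: (ex_intro2 _ _ _ inP); rewrite scalerA mulfV ?oner_eq0 // scale1r.
Qed.

(** A linear form that is at least [c] at the vertices is at least [n * c] on the
    [n]-th dilate. *)
Lemma dilate_weight n (a : 'X_{1..s}) (z : 'I_s -> R) c :
    (forall i j, G i j -> c <= z i + z j) ->
    dilate n (edge_polytope R G) (vec_of_mnm R a) ->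
  n%:R * c <= \sum_i z i * (a i)%:R.
Proof.
move=> zc [_ [m [w [p [w0 w1 Pp ->]]]] def_a].
pose ell (v : 'rV[R]_s) := \sum_i z i * v 0 i.
have ellE : \sum_i z i * (a i)%:R = n%:R * \sum_k w k * ell (p k).
  transitivity (ell (vec_of_mnm R a)); first by apply: eq_bigr => i _; rewrite mxE.
  rewrite def_a /ell mulr_sumr; under [in RHS]eq_bigr do rewrite !mulr_sumr.
  rewrite exchange_big; apply: eq_bigr => i _ /=.
  rewrite mxE summxE !mulr_sumr; apply: eq_bigr => k _; rewrite mxE.
  by rewrite mulrCA; congr (_ * _); rewrite mulrCA.
rewrite ellE ler_wpM2l ?ler0n // -[c]mul1r -w1 mulr_suml; apply: ler_sum => k _.
rewrite ler_wpM2l //; have [i [j [Gij ->]]] := Pp k.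
suff -> : ell (unit_vec R i + unit_vec R j) = z i + z j by apply: zc.
have ell1 l : \sum_k z k * unit_vec R l 0 k = z l.
  rewrite (bigD1 l) //= mxE !eqxx mulr1 big1 ?addr0 // => t /negPf neq.
  by rewrite mxE neq andbF mulr0.
by rewrite /ell -[in RHS](ell1 i) -[in RHS](ell1 j) -big_split; apply: eq_bigr => t _;
  rewrite mxE mulrDr.
Qed.

Lemma dilate_cover_weight n (a : 'X_{1..s}) (S : {set 'I_s}) :
    dilate n (edge_polytope R G) (vec_of_mnm R a) ->
  (n.*2 <= \sum_i cover_weight G S i * a i)%N.
Proof.
move=> Pa; rewrite -(ler_nat R) -muln2 natrM natr_sum.
under eq_bigr do rewrite natrM.
apply: dilate_weight Pa => i j Gij; rewrite -natrD ler_nat.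
by apply: cover_weight_edge Gij; apply: adj_sym.
Qed.

(** All vertices of the polytope lie on the hyperplane of degree 2. *)
Lemma dilate_mdeg n (a : 'X_{1..s}) :
  dilate n (edge_polytope R G) (vec_of_mnm R a) -> (mdeg a <= n.*2)%N.
Proof.
move=> Pa; rewrite mdegE -(ler_nat R) -muln2 natrM natr_sum -lerN2 -mulrN -sumrN.
under eq_bigr do rewrite -mulN1r.
by apply: dilate_weight Pa => i j _; rewrite -opprD.
Qed.
End Polytope.

Section Ehrhart.
Variables (R : realType) (K : fieldType) (s : nat) (G : sgraph s).

(** The exponent of [t^a z^n]. *)
Definition lift_mnm n (a : 'X_{1..s}) : 'X_{1..s.+1} :=
  (mnmwiden a + U_(ord_max) *+ n)%MM.

Lemma lift_mnmX n a :
  mwiden 'X_[a] * zvar K s ^+ n = 'X_[lift_mnm n a] :> {mpoly K[s.+1]}.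
Proof. by rewrite mwidenX /zvar mpolyXn mpolyXD. Qed.

Lemma lift_mnm_inj n1 a1 n2 a2 : lift_mnm n1 a1 = lift_mnm n2 a2 ->
  n1 = n2 /\ a1 = a2.
Proof.
move=> e; have e_at i : lift_mnm n1 a1 i = lift_mnm n2 a2 i by rewrite e.
have en : n1 = n2.
  by have := e_at ord_max; rewrite !mnmDE !mulmnE !mnm1E eqxx !mnmwiden_ordmax !mul1n.
split=> //; apply: inj_mnmwiden; move: e; rewrite /lift_mnm en.
by apply: addIm.
Qed.

Lemma lift_mnm_cat (E F : seq ('I_s * 'I_s)) :
  lift_mnm (size (E ++ F)) (walk_mnm (endpoints (E ++ F))) =
  (lift_mnm (size E) (walk_mnm (endpoints E)) +
   lift_mnm (size F) (walk_mnm (endpoints F)))%MM.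
Proof.
rewrite /lift_mnm size_cat endpoints_cat walk_mnm_cat mnmwidenD.
by apply/mnmP => i; rewrite !mnmDE !mulmnE mulnDr; lia.
Qed.

Lemma lift_mnm_prod (E : seq ('I_s * 'I_s)) :
  'X_[lift_mnm (size E) (walk_mnm (endpoints E))] =
  \prod_(p <- E) (mwiden ('X_p.1 * 'X_p.2) * zvar K s) :> {mpoly K[s.+1]}.
Proof.
elim: E => [|p E IHE].
  by rewrite big_nil -lift_mnmX walk_mnm_nil mpolyX0 mwiden1 mulr1.
rewrite big_cons -IHE -(cat1s p) lift_mnm_cat mpolyXD.
by rewrite -[size [:: p]]/1%N -[in LHS]lift_mnmX edge_mnm expr1.
Qed.

(** A subalgebra generated by monomials is spanned by the products of generators; the
    degree in [z] counts the factors. *)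
Lemma edge_subring_supp f m : edge_subring K G f -> m \in msupp f ->
  exists2 E, edges_of G E & m = lift_mnm (size E) (walk_mnm (endpoints E)).
Proof.
move=> Gf; move: m; pose Y (f : {mpoly K[s.+1]}) := forall m, m \in msupp f ->
  exists2 E, edges_of G E & m = lift_mnm (size E) (walk_mnm (endpoints E)).
apply: (subalgebra_gen_min (Y := Y)) Gf.
- move=> m; rewrite msupp1 inE => /eqP ->; exists [::] => //.
  by rewrite walk_mnm_nil /lift_mnm mnmwiden0 mulm0n addm0.
- move=> c u v Yu Yv m /msuppD_le; rewrite mem_cat => /orP[/msuppZ_le/Yu|/Yv] //.
- move=> u v Yu Yv m /msuppM_le/allpairsP[[m1 m2] /= [/Yu[E eE ->] /Yv[F eF ->] ->]].
  by exists (E ++ F); rewrite ?edges_of_cat ?eE // lift_mnm_cat.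
- move=> _ [i [j [Gij ->]]] m.
  have := lift_mnm_prod [:: (i, j)]; rewrite big_seq1 => <-.
  by rewrite msuppX inE => /eqP ->; exists [:: (i, j)]; rewrite /= ?Gij.
Qed.

Lemma edge_subring_sub_ehrhart :
  (edge_subring K G `<=` ehrhart_ring K (edge_polytope R G))%classic.
Proof.
apply: subalgebra_gen_sub => _ [i [j [Gij ->]]]; apply: subalgebra_gen_mem.
exists 1%N, (walk_mnm [:: i; j]); split; first exact: edge_dilate.
by have /= -> := edge_mnm K (i, j); rewrite expr1.
Qed.

(** The packing theorem gives [n] edges with sum at most [a]; both have degree [2 n],
    so they agree and [t^a z^n] is a product of generators. *)
Lemma linked_ehrhart : linked_odd_walks G ->
  edge_subring K G = ehrhart_ring K (edge_polytope R G).
Proof.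
move=> link; apply/seteqP; split; first exact: edge_subring_sub_ehrhart.
apply: subalgebra_gen_sub => _ [n [a [Pa ->]]].
have [E [eE sE cE]] := linked_packing link (fun S => dilate_cover_weight S Pa).
have le : (walk_mnm (endpoints E) <= a)%MM.
  by apply/mnm_lepP => i; rewrite walk_mnmE.
have mdeg_walk w : mdeg (walk_mnm w : 'X_{1..s}) = size w.
  elim: w => [|i w IHw]; first by rewrite walk_mnm_nil mdeg0.
  by rewrite -cat1s walk_mnm_cat mdegD IHw walk_mnm1 mdeg1.
have def_a : walk_mnm (endpoints E) = a.
  have := congr1 (@mdeg s) (submK le).
  have := dilate_mdeg Pa; rewrite mdegD mdeg_walk size_endpoints sE => le2 e.
  have : mdeg (a - walk_mnm (endpoints E))%MM = 0%N by lia.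
  by move/eqP; rewrite mdeg_eq0 => /eqP d0; rewrite -[RHS](submK le) d0 add0m.
rewrite lift_mnmX -def_a -sE lift_mnm_prod; apply: subalgebra_gen_prod => p pE.
by exists p.1, p.2; split=> //; apply: (allP eE).
Qed.

Lemma ehrhart_linked :
  edge_subring K G = ehrhart_ring K (edge_polytope R G) -> linked_odd_walks G.
Proof.
move=> eqn w1 w2 o1 o2.
have [n [E [n_gt0 sw eE sE pE]]] := odd_walks_arcs o1 o2.
have : ehrhart_ring K (edge_polytope R G) 'X_[lift_mnm n (walk_mnm (w1 ++ w2))].
  apply: subalgebra_gen_mem; exists n, (walk_mnm (w1 ++ w2)).
  by rewrite lift_mnmX; split=> //; apply: half_cover_dilate pE.
rewrite -eqn => /edge_subring_supp inE.
have [|F eF /lift_mnm_inj[sF wF]] := inE (lift_mnm n (walk_mnm (w1 ++ w2))).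
  by rewrite msuppX mem_seq1.
apply: perm_cover_linked o1 o2 eF _; first exact: adj_sym.
apply: perm_eq_count_le; first by rewrite size_endpoints -sF sw.
by move=> i; rewrite -!walk_mnmE wF.
Qed.
End Ehrhart.

(** * The equivalence *)

Theorem theorem8p23 (R : realType) (K : fieldType) (s : nat) (G : sgraph s) :
  let cond_i :=
    edge_subring K G = ehrhart_ring K (edge_polytope R G) in
  let cond_ii :=
    (#|[set C in components G | ~~ bipartite (induced G C)]%SET| <= 1)%N /\
    (forall C : {set 'I_s},
       C \in components G -> ~~ bipartite (induced G C) ->
       normal_ideal (edge_ideal K (induced G C))) in
  let cond_iii := normal_ideal (edge_ideal K G) in
  (cond_i <-> cond_ii) /\ (cond_ii <-> cond_iii).
Proof.
have normalP (H : sgraph s) : normal_ideal (edge_ideal K H) <-> linked_odd_walks H.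
  by split; [apply: normal_linked | apply: linked_normal].
have ehrhartP : edge_subring K G = ehrhart_ring K (edge_polytope R G) <->
    linked_odd_walks G.
  by split; [apply: ehrhart_linked | apply: linked_ehrhart].
have cond_iiP : (#|[set C in components G | ~~ bipartite (induced G C)]%SET| <= 1)%N /\
    (forall C : {set 'I_s},
       C \in components G -> ~~ bipartite (induced G C) ->
       normal_ideal (edge_ideal K (induced G C))) <-> linked_odd_walks G.
  rewrite linked_components; split=> -[one all_C]; split=> // C cC nC.
    by apply/normalP/all_C.
  by apply/normalP/all_C.
move=> cond_i cond_ii cond_iii; split.
  exact: iff_trans ehrhartP (iff_sym cond_iiP).
exact: iff_trans cond_iiP (iff_sym (normalP G)).
Qed.
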